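(* Let $N\ge1$. The map $I:S_{N+1}\to S_{N+1}$, $\pi\mapsto\overline\pi$, defined by $$\overline{\pi}(1)=N+2-\pi(1),\qquad \overline{\pi}(i)=N+2-\pi(N+3-i)\quad (2\le i\le N+1),$$ has the following properties for every $\pi\in S_{N+1}$: (1) $\mathrm{pr}(\pi)=\overline{\mathrm{pr}(\overline\pi)}$; (2) $\mathrm{rk}(\pi)=\mathrm{rk}(\overline\pi)$; (3) $u(\pi)=f(\overline\pi)$; (4) $f(\pi)=u(\overline\pi)$.
   Context: For $\tau=(\tau_1,\dots,\tau_N)\in\{0,1\}^N$ (a state of the PASEP with $N$ sites), the particle-hole symmetry is $\overline{(\tau_1,\dots,\tau_N)}=(1-\tau_N,1-\tau_{N-1},\dots,1-\tau_1)$. For $\pi\in S_{N+1}$: a weak excedance is an index $i$ with $\pi(i)\ge i$. $\mathrm{pr}(\pi)=(a_1,\dots,a_N)\in\{0,1\}^N$ with $a_i=1$ if $i+1$ is a weak excedance of $\pi$ and $a_i=0$ otherwise. A crossing of $\pi$ is a pair of indices $i,j$ such that either $i<j\le\pi(i)<\pi(j)$ or $\pi(i)<\pi(j)<i<j$; $\mathrm{rk}(\pi)$ is the number of crossings of $\pi$. A LR-maximum is an index $i$ with $\pi(i)>\pi(j)$ for all $j<i$; it is special if in addition $\pi(i)>\pi(1)$. A RL-minimum is an index $i$ with $\pi(i)<\pi(j)$ for all $j>i$; it is special if in addition $\pi(i)<\pi(1)$. $u(\pi)$ is the number of special LR-maxima of $\pi$ and $f(\pi)$ is the number of special RL-minima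 of $\pi$. *)

(* Defs.v *)
From mathcomp Require Import all_boot all_fingroup.

Set Implicit Arguments.
Unset Strict Implicit.
Unset Printing Implicit Defensive.

(* Permutations of {1, ..., N+1} are encoded as 'S_N.+1, acting on {0, ..., N}:
   index k is represented by the ordinal of value k - 1, and similarly for the
   values of the permutation.  Sites 1, ..., N are likewise represented by
   'I_N.  In particular N + 2 - v becomes rev_ord v on 'I_N.+1. *)

Definition pasep_state (N : nat) := {ffun 'I_N -> bool}.

Definition particle_hole (N : nat) (tau : pasep_state N) : pasep_state N :=
  [ffun i => ~~ tau (rev_ord i)].

Definition weak_excedance (n : nat) (pi : 'S_n) (i : 'I_n) : bool := i <= pi i.

(* lift ord0 i is the ordinal of value i + 1. *)
Definition pr (N : nat) (pi : 'S_N.+1) : pasep_state N :=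
  [ffun i => weak_excedance pi (lift ord0 i)].

Definition crossing (n : nat) (pi : 'S_n) (i j : 'I_n) : bool :=
  [&& i < j, j <= pi i & pi i < pi j] || [&& pi i < pi j, pi j < i & i < j].

Definition rk (n : nat) (pi : 'S_n) : nat :=
  #|[set ij : 'I_n * 'I_n | crossing pi ij.1 ij.2]|.

Definition lr_maximum (n : nat) (pi : 'S_n) (i : 'I_n) : bool :=
  [forall j : 'I_n, (j < i) ==> (pi j < pi i)].

Definition rl_minimum (n : nat) (pi : 'S_n) (i : 'I_n) : bool :=
  [forall j : 'I_n, (i < j) ==> (pi i < pi j)].

Definition special_lr_maximum (N : nat) (pi : 'S_N.+1) (i : 'I_N.+1) : bool :=
  lr_maximum pi i && (pi ord0 < pi i).

Definition special_rl_minimum (N : nat) (pi : 'S_N.+1) (i : 'I_N.+1) : bool :=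
  rl_minimum pi i && (pi i < pi ord0).

Definition u (N : nat) (pi : 'S_N.+1) : nat :=
  #|[set i | special_lr_maximum pi i]|.

Definition f (N : nat) (pi : 'S_N.+1) : nat :=
  #|[set i | special_rl_minimum pi i]|.

(* In 1-based terms, index k >= 2 is sent to N + 3 - k; with i = k - 1 this is
   the ordinal of value (N + 3 - k) - 1 = N + 1 - i. *)
Definition perm_bar_fun (N : nat) (pi : 'S_N.+1) (i : 'I_N.+1) : 'I_N.+1 :=
  if i == ord0 then rev_ord (pi ord0)
  else rev_ord (pi (inord (N.+1 - i))).

Lemma perm_bar_fun_inj (N : nat) (pi : 'S_N.+1) : injective (perm_bar_fun pi).
Proof.
have inordK' (i : 'I_N.+1) :
    i != ord0 -> (inord (N.+1 - i) : 'I_N.+1) = N.+1 - i :> nat.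
  by move=> i0; rewrite inordK // ltn_subrL lt0n i0.
have inord_neq0 (i : 'I_N.+1) :
    i != ord0 -> (inord (N.+1 - i) : 'I_N.+1) <> ord0.
  move=> i0 /(congr1 val) /=; rewrite inordK' // => /eqP.
  by rewrite subn_eq0 leqNgt ltn_ord.
move=> i j; rewrite /perm_bar_fun.
case: (altP (i =P ord0)) => [->|i0]; case: (altP (j =P ord0)) => [->|j0] //.
- by move/rev_ord_inj/perm_inj/esym/(inord_neq0 _ j0).
- by move/rev_ord_inj/perm_inj/(inord_neq0 _ i0).
move/rev_ord_inj/perm_inj/(congr1 val); rewrite /= !inordK' // => eq_ij.
by apply/val_inj; rewrite /= -(subKn (ltnW (ltn_ord i))) eq_ij subKn // ltnW.
Qed.

Definition perm_bar (N : nat) (pi : 'S_N.+1) : 'S_N.+1 :=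
  perm (@perm_bar_fun_inj N pi).

(* Main.v *)
Require Import Defs.
From mathcomp Require Import all_boot all_fingroup.
From mathcomp Require Import zify.

(** Let [s] (below, [tail_rev]) be the map on indices that fixes the first one
    and reverses the others.  The bar map is characterised by
    [perm_bar pi (s i) = rev_ord (pi i)], and is therefore an involution.
    Away from the first index it reverses both positions and values, which
    turns left-to-right maxima into right-to-left minima.  Since the first
    value is reversed as well, being special is preserved; this gives
    [u pi = f (perm_bar pi)], and the companion identity follows by
    involutivity.  The centre around which positions are reversed lies half a
    step to the right of the one for values, so a weak excedance [i <= pi i]
    becomes a strict anti-excedance; this is the particle-hole symmetry.

    The same half step exchanges the two kinds of crossings: the weak
    inequality of an upper crossing [i < j <= pi i < pi j] becomes the strict
    one of a lower crossing [pi i < pi j < i < j].  Only the upper crossings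
    whose smaller index is the first one escape this exchange.  They correspond
    to the [j] with [j <= a < pi j], where [a = pi ord0]; for [perm_bar pi],
    the corresponding indices are the images under [s] of the [j] with
    [pi j <= a < j].  The two families have the same size because [pi] is a
    bijection: as many elements leave the initial segment [{0, ..., a}] as
    enter it ([card_leave_enter]). *)

Set Implicit Arguments.
Unset Strict Implicit.
Unset Printing Implicit Defensive.

(** * The bar map as an involution *)

Section Reflection.

Variable N : nat.
Implicit Types (pi : 'S_N.+1) (i j : 'I_N.+1).

Definition tail_rev i : 'I_N.+1 := if i == ord0 then ord0 else inord (N.+1 - i).

Lemma val_tail_rev i : tail_rev i = (if i == 0 :> nat then 0 else N.+1 - i) :> nat.
Proof.
rewrite /tail_rev -val_eqE /=; case: ifP => // i0.
by rewrite inordK //; lia.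
Qed.

Lemma tail_revK : involutive tail_rev.
Proof.
move=> i; apply/val_inj; rewrite /= !val_tail_rev.
by have := ltn_ord i; case: (posnP i) => [->|i0] //=; case: ifP; lia.
Qed.

Lemma perm_bar_tail_rev pi i : perm_bar pi (tail_rev i) = rev_ord (pi i).
Proof.
rewrite permE /perm_bar_fun; have := val_tail_rev i.
have [->|i0] := eqVneq i ord0; first by rewrite /tail_rev eqxx.
move: i0; rewrite -!val_eqE /= => /negPf i0; rewrite i0 => si.
rewrite si ifF; last by have := ltn_ord i; lia.
by rewrite subKn ?inord_val // ltnW.
Qed.

Lemma perm_bar0 pi : perm_bar pi ord0 = rev_ord (pi ord0).
Proof. by rewrite -perm_bar_tail_rev /tail_rev eqxx. Qed.

Lemma perm_barK : involutive (@perm_bar N).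
Proof.
move=> pi; apply/permP => i.
by rewrite -{1}(tail_revK i) !perm_bar_tail_rev rev_ordK.
Qed.

Lemma val_perm_bar_tail_rev pi i : perm_bar pi (tail_rev i) = N - pi i :> nat.
Proof. by rewrite perm_bar_tail_rev /= subSS. Qed.

Lemma val_perm_bar0 pi : perm_bar pi ord0 = N - pi ord0 :> nat.
Proof. by rewrite perm_bar0 /= subSS. Qed.

(** * Weak excedances and special extrema *)

Lemma pr_perm_bar pi : pr pi = particle_hole (pr (perm_bar pi)).
Proof.
apply/ffunP => i; rewrite !ffunE /weak_excedance.
have -> : lift ord0 (rev_ord i) = tail_rev (lift ord0 i).
  by apply/val_inj; rewrite /= val_tail_rev /= !/bump /=; have := ltn_ord i; lia.
rewrite val_perm_bar_tail_rev val_tail_rev /= !/bump /=.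
by have := ltn_ord i; have := ltn_ord (pi (lift ord0 i)); lia.
Qed.

(** The first index is never a special extremum. For any other index, comparing
    with the first value is part of being special, and all the other
    comparisons involve indices whose order [tail_rev] reverses. *)
Lemma special_rl_minimum_perm_bar pi i :
  special_rl_minimum (perm_bar pi) (tail_rev i) = special_lr_maximum pi i.
Proof.
rewrite /special_rl_minimum /special_lr_maximum.
have [->|i0] := eqVneq i ord0; first by rewrite /tail_rev eqxx !ltnn !andbF.
have {}i0 : 0 < i by rewrite lt0n.
have bnd := ltn_ord; have := val_tail_rev i; rewrite gtn_eqF // => si.
have pi_i := val_perm_bar_tail_rev pi i; have pi_0 := val_perm_bar0 pi.
have := bnd _ i; have := bnd _ (pi i); have := bnd _ (pi ord0) => b0 bpi bi.
rewrite pi_i pi_0.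
apply/andP/andP => -[/forallP ext sp]; split; try lia.
- apply/forallP => j; apply/implyP => lt_ji.
  have [->|j0] := eqVneq j ord0; first by lia.
  have {}j0 : 0 < j by rewrite lt0n.
  have /implyP := ext (tail_rev j).
  rewrite pi_i si val_perm_bar_tail_rev val_tail_rev gtn_eqF //.
  by have := bnd _ j; have := bnd _ (pi j); lia.
- apply/forallP => k; apply/implyP; rewrite -(tail_revK k).
  move: (tail_rev k) => j; rewrite pi_i si val_perm_bar_tail_rev val_tail_rev.
  have /implyP := ext j; have := bnd _ j; have := bnd _ (pi j).
  by case: ifP => ?; lia.
Qed.

Lemma u_perm_bar pi : u pi = f (perm_bar pi).
Proof.
rewrite /u /f -[RHS](card_preimset _ (inv_inj tail_revK)).
by apply: eq_card => i; rewrite !inE special_rl_minimum_perm_bar.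
Qed.

(** * Crossings *)

Definition upper_crossings pi :=
  [set ij : 'I_N.+1 * 'I_N.+1 | [&& 0 < ij.1, ij.1 < ij.2, ij.2 <= pi ij.1 & pi ij.1 < pi ij.2]].

Definition lower_crossings pi :=
  [set ij : 'I_N.+1 * 'I_N.+1 | [&& pi ij.1 < pi ij.2, pi ij.2 < ij.1 & ij.1 < ij.2]].

(** These are the larger indices of the upper crossings that involve
    [ord0]; [ord0] itself is excluded by the strict inequality. *)
Definition first_crossings pi :=
  [set j : 'I_N.+1 | j <= pi ord0 < pi j].

Lemma rk_decomp pi :
  rk pi = #|upper_crossings pi| + #|lower_crossings pi| + #|first_crossings pi|.
Proof.
have pair_inj : injective (fun j : 'I_N.+1 => (ord0 : 'I_N.+1, j)) by move=> ? ? [].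
rewrite -(card_imset (first_crossings pi) pair_inj).
rewrite /rk -cardsUI.
have -> : upper_crossings pi :&: lower_crossings pi = set0.
  by apply/setP => -[i j]; rewrite !inE /=; lia.
rewrite cards0 addn0 -cardsUI.
set X := _ :&: _; have -> : X = set0.
  apply/setP => ij; rewrite !inE; apply/negbTE/negP => /andP[+ /imsetP[j _ ij0]].
  by rewrite ij0 /=; lia.
rewrite cards0 addn0; apply: eq_card => -[i j]; rewrite !inE /crossing /=.
have -> : ((i, j) \in [set (ord0, x) | x in first_crossings pi])
          = (i == ord0) && (j <= pi ord0 < pi j).
  apply/imsetP/andP => [[k] | [/eqP-> jP]]; last by exists j; rewrite ?inE.
  by rewrite inE => ? [-> ->].
have [->|i0] := eqVneq i ord0.
  rewrite /=; have [->|j0] := eqVneq j ord0; first by rewrite /= !ltnn; lia.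
  have {}j0 : 0 < j by rewrite lt0n.
  by lia.
have {}i0 : 0 < i by rewrite lt0n.
by lia.
Qed.

(** Reversing positions also swaps the two indices of a crossing. *)
Lemma card_upper_crossings pi :
  #|upper_crossings pi| = #|lower_crossings (perm_bar pi)|.
Proof.
pose g (ij : 'I_N.+1 * 'I_N.+1) := (tail_rev ij.2, tail_rev ij.1).
have gK : involutive g by case=> i j; rewrite /g /= !tail_revK.
rewrite -[RHS](card_preimset _ (inv_inj gK)).
apply: eq_card => -[i j]; rewrite !inE /= !val_perm_bar_tail_rev !val_tail_rev.
have := ltn_ord i; have := ltn_ord j.
have := ltn_ord (pi i); have := ltn_ord (pi j).
by do 2 case: ifP => ?; lia.
Qed.

(** [A] and its preimage have the same size, so what remains of each after
    removing their intersection has the same size as well. *)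
Lemma card_leave_enter (T : finType) (p : {perm T}) (A : {set T}) :
  #|A :\: p @^-1: A| = #|p @^-1: A :\: A|.
Proof.
by rewrite !cardsD (card_preimset _ (@perm_inj _ p)) setIC.
Qed.

Lemma card_first_crossings pi :
  #|first_crossings pi| = #|first_crossings (perm_bar pi)|.
Proof.
pose A := [set j : 'I_N.+1 | j <= pi ord0].
have -> : first_crossings pi = A :\: pi @^-1: A.
  by apply/setP => j; rewrite !inE -ltnNge andbC.
rewrite card_leave_enter.
have -> : pi @^-1: A :\: A = [set j : 'I_N.+1 | pi j <= pi ord0 < j].
  by apply/setP => j; rewrite !inE -ltnNge andbC.
rewrite -[RHS](card_preimset _ (inv_inj tail_revK)).
apply: eq_card => j; rewrite !inE val_perm_bar_tail_rev val_perm_bar0 val_tail_rev.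
have := ltn_ord (pi ord0); have := ltn_ord (pi j); have := ltn_ord j.
have [->|j0] := eqVneq j ord0; first by rewrite /=; lia.
have pi_j : pi j != pi ord0 :> nat by rewrite val_eqE (inj_eq perm_inj).
have {}j0 : 0 < j by rewrite lt0n.
by rewrite (gtn_eqF j0); lia.
Qed.

Lemma rk_perm_bar pi : rk pi = rk (perm_bar pi).
Proof.
rewrite !rk_decomp card_first_crossings !card_upper_crossings perm_barK.
by rewrite (addnC #|lower_crossings pi|).
Qed.

End Reflection.

Theorem theorem7p2 (N : nat) (hN : 1 <= N) (pi : 'S_N.+1) :
  [/\ pr pi = particle_hole (pr (perm_bar pi)),
      rk pi = rk (perm_bar pi),
      u pi = f (perm_bar pi)
    & f pi = u (perm_bar pi)].
Proof.
split; [exact: pr_perm_bar | exact: rk_perm_bar | exact: u_perm_bar |].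
by rewrite u_perm_bar perm_barK.
Qed.
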